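(* Let $\Omega\subset\mathbb{R}^d$ be an open and bounded domain with piecewise-smooth boundary and outward pointing unit normal $\boldsymbol{n}$, let $\boldsymbol{\xi}\in\mathbb{R}^d$ be a directional vector of length one, and let $S=\{\mathbf{x}_n\}_{n=1}^N$ be a set of $N$ nodes in $\overline{\Omega}$. Let $\mathcal{F}\subset C^1(\Omega)$ be a finite-dimensional linear function space with basis $\{f_1,\dots,f_K\}$, and assume that the Vandermonde matrix $V=(f_k(\mathbf{x}_n))_{n=1,\dots,N;\,k=1,\dots,K}\in\mathbb{R}^{N\times K}$ has linearly independent columns. Further, let $B_{\boldsymbol{\xi}}\in\mathbb{R}^{N\times N}$ be a (diagonal) boundary matrix satisfying $$\mathbf{f}^T B_{\boldsymbol{\xi}}\,\mathbf{g}=\oint_{\partial\Omega} f g\,(\boldsymbol{\xi}\cdot\boldsymbol{n})\,\mathrm{d}s\qquad\text{for all } f,g\in\mathcal{F}.$$ Then there exists a diagonal-norm $\mathcal{F}$-based MFSBP operator $D_{\boldsymbol{\xi}}=P^{-1}Q_{\boldsymbol{\xi}}$ with $Q_{\boldsymbol{\xi}}+Q_{\boldsymbol{\xi}}^T=B_{\boldsymbol{\xi}}$ on the nodes $S$ if and only if there exists a positive and $\partial_{\boldsymbol{\xi}}(\mathcal{F}^2)$-exact quadrature on $\Omega$ with nodes $S$.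
   Context: Notation. For a function $f\in C^1(\Omega)$, $\partial_{\boldsymbol{\xi}}f=\nabla f\cdot\boldsymbol{\xi}$ is the directional derivative, and $\mathbf{f}=[f(\mathbf{x}_1),\dots,f(\mathbf{x}_N)]^T$ and $\mathbf{f}_{\boldsymbol{\xi}}=[(\partial_{\boldsymbol{\xi}}f)(\mathbf{x}_1),\dots,(\partial_{\boldsymbol{\xi}}f)(\mathbf{x}_N)]^T$ are the vectors of nodal values on $S$. Nodes may lie on $\partial\Omega$; functions in $\mathcal{F}$ and their first derivatives are understood to extend continuously to $\overline{\Omega}$, so that nodal values and boundary integrals make sense and integration by parts holds: $\int_\Omega u\,(\partial_{\boldsymbol{\xi}}v)\,\mathrm{d}\boldsymbol{x}+\int_\Omega(\partial_{\boldsymbol{\xi}}u)\,v\,\mathrm{d}\boldsymbol{x}=\oint_{\partial\Omega}uv\,(\boldsymbol{\xi}\cdot\boldsymbol{n})\,\mathrm{d}s$. MFSBP operator. A matrix $D_{\boldsymbol{\xi}}=P^{-1}Q_{\boldsymbol{\xi}}\in\mathbb{R}^{N\times N}$ is an $\mathcal{F}$-based multi-dimensional function-space summation-by-parts (MFSBP) operator on $S$, approximating $\partial_{\boldsymbol{\xi}}$, if (i) $D_{\boldsymbol{\xi}}\mathbf{f}=\mathbf{f}_{\boldsymbol{\xi}}$ for all $f\in\mathcal{F}$; (ii) the norm matrix $P$ is symmetric and positive definite; (iii) $Q_{\boldsymbol{\xi}}+Q_{\boldsymbol{\xi}}^T=B_{\boldsymbol{\xi}}$; and (iv) the boundary matrix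 $B_{\boldsymbol{\xi}}$ satisfies $\mathbf{f}^TB_{\boldsymbol{\xi}}\mathbf{g}=\oint_{\partial\Omega}fg\,(\boldsymbol{\xi}\cdot\boldsymbol{n})\,\mathrm{d}s$ for all $f,g\in\mathcal{F}$. It is called diagonal-norm if $P$ is a diagonal matrix. Boundary matrices are restricted to be diagonal. Quadratures. A quadrature on $\Omega$ with nodes $S=\{\mathbf{x}_n\}_{n=1}^N$ and weights $W=\{w_n\}_{n=1}^N\subset\mathbb{R}$ is the functional $I_{S,W}[f]=\sum_{n=1}^N w_n f(\mathbf{x}_n)$. It is positive if $w_n>0$ for all $n=1,\dots,N$. Given a set of functions $\mathcal{G}$, it is $\mathcal{G}$-exact if $I_{S,W}[g]=\int_\Omega g(\boldsymbol{x})\,\mathrm{d}\boldsymbol{x}$ for all $g\in\mathcal{G}$. Finally, $$\partial_{\boldsymbol{\xi}}(\mathcal{F}^2)=\{\,\partial_{\boldsymbol{\xi}}(fg)\mid f,g\in\mathcal{F}\,\}=\{\,(\partial_{\boldsymbol{\xi}}f)g+f(\partial_{\boldsymbol{\xi}}g)\mid f,g\in\mathcal{F}\,\}.$$ *)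

(* Defs.v *)
From HB Require Import structures.
From mathcomp Require Import all_boot all_order all_algebra.
From mathcomp Require Import all_classical all_reals all_analysis.
From mathcomp Require Import measurable_realfun.

Set Implicit Arguments.
Unset Strict Implicit.
Unset Printing Implicit Defensive.

Import Order.TTheory GRing.Theory Num.Theory.
Import numFieldNormedType.Exports.

Local Open Scope classical_set_scope.
Local Open Scope ring_scope.

Definition mx_display : measure_display. Proof. exact: default_measure_display. Qed.

Section mx_borel.
Context {R : realType} {m n : nat}.

HB.instance Definition _ := @isMeasurable.Build mx_display 'M[R]_(m, n)
  <<s @open 'M[R]_(m, n) >> (@sigma_algebra0 _ setT open)
  (@sigma_algebraC _ open) (@sigma_algebra_bigcup _ setT open).

End mx_borel.

Lemma open_measurable_mx {R : realType} {m n : nat} (U : set 'M[R]_(m, n)) :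
  open U -> measurable U.
Proof. exact: sub_sigma_algebra. Qed.

Lemma rV_ballE {R : realType} {n : nat} (x y : 'rV[R]_n) (e : R) :
  ball x e y <-> 0 < e /\ forall j, ball (x ord0 j) e (y ord0 j).
Proof.
split=> [[e0 xy]|[e0 xy]]; first by split=> // j; exact: xy.
by split=> // i j; rewrite !ord1; exact: xy.
Qed.

Section rV_cons.
Context {R : realType} (n : nat).

Definition rV_cons (p : measurableTypeR R * 'rV[R]_n) : 'rV[R]_n.+1 :=
  \row_(i < n.+1) if unlift ord0 i is Some j then p.2 ord0 j else p.1.

Definition rV_uncons (v : 'rV[R]_n.+1) : measurableTypeR R * 'rV[R]_n :=
  (v ord0 ord0, \row_(j < n) v ord0 (lift ord0 j)).

Lemma rV_cons0 p : rV_cons p ord0 ord0 = p.1.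
Proof. by rewrite mxE unlift_none. Qed.

Lemma rV_consS p j : rV_cons p ord0 (lift ord0 j) = p.2 ord0 j.
Proof. by rewrite mxE liftK. Qed.

Lemma rV_consK : cancel rV_cons rV_uncons.
Proof.
move=> [t v]; rewrite /rV_uncons rV_cons0; congr (_, _).
by apply/rowP => j; rewrite mxE rV_consS.
Qed.

Lemma rV_unconsK : cancel rV_uncons rV_cons.
Proof.
move=> v; apply/rowP => i.
by case: (unliftP ord0 i) => [j|] ->; rewrite ?rV_cons0 ?rV_consS ?mxE.
Qed.

Lemma measurable_rV_cons : measurable_fun setT rV_cons.
Proof.
apply: (@measurability _ _ _ _ setT rV_cons (@open 'rV[R]_n.+1)) => // _ [U oU <-]; rewrite setTI.
pose q_ (q : 'rV[rat]_n.+1) : 'rV[R]_n.+1 := map_mx ratr q.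
pose F (i : 'rV[rat]_n.+1 * nat) : set (measurableTypeR R * 'rV[R]_n) :=
  [set p | ball (q_ i.1) i.2.+1%:R^-1 `<=` U
    /\ ball (q_ i.1) i.2.+1%:R^-1 (rV_cons p)].
have -> : rV_cons @^-1` U = \bigcup_i F i.
  apply/seteqP; split => [p /= Up|p [i _ [iU ip]]]; last exact: iU.
  have [e /= e0 eU] : exists2 e : R, 0 < e & ball (rV_cons p) e `<=` U.
    by apply/nbhs_ballP; exact: open_nbhs_nbhs.
  have [k ke] : exists k, k.+1%:R^-1 < e / 2 :> R.
    have := near_infty_natSinv_lt (PosNum (divr_gt0 e0 (@ltr0Sn R 1))).
    by case=> k _ /(_ k (leqnn k)) /= ?; exists k.
  have k0 : 0 < k.+1%:R^-1 :> R by rewrite invr_gt0 ltr0n.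
  have /choice[q qP] i : exists r : rat,
      `|ratr r - rV_cons p ord0 i| < k.+1%:R^-1 :> R.
    have /rat_in_itvoo[r] : rV_cons p ord0 i - k.+1%:R^-1
      < rV_cons p ord0 i + k.+1%:R^-1 by rewrite ltrD2l gtrN.
    rewrite in_itv/= => /andP[r1 r2]; exists r.
    by rewrite ltr_distl r1 r2.
  have qp : ball (q_ (\row_i q i)) k.+1%:R^-1 (rV_cons p).
    by apply/rV_ballE; split => // j; rewrite [X in ball X _ _]mxE [X in ratr X]mxE; exact: qP.
  exists (\row_i q i, k) => //; split => //= y yq; apply: eU.
  apply: (@le_ball _ _ _ (k.+1%:R^-1 + k.+1%:R^-1)).
    by rewrite [leRHS]splitr lerD// ltW.
  by apply: ball_triangle yq; exact: ball_sym.
apply: countable_bigcupT_measurable => //= -[q k].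
have [qU|qU] := pselect (ball (q_ q) k.+1%:R^-1 `<=` U); last first.
  by rewrite (_ : F _ = set0)//; apply/seteqP; split => // p [].
rewrite (_ : F _ = ball (q_ q ord0 ord0) k.+1%:R^-1 `*`
   ball (\row_j q_ q ord0 (lift ord0 j)) k.+1%:R^-1).
  apply: measurableX; first exact: measurable_ball.
  by apply: open_measurable_mx; exact: ball_open.
apply/seteqP; split => [p [_ /= /rV_ballE[k0 qp]]|p [/= p1 /rV_ballE[k0 p2]]].
  split=> /=; first by have := qp ord0; rewrite rV_cons0.
  by apply/rV_ballE; split => // j; rewrite -rV_consS mxE; exact: qp.
split => //=; apply/rV_ballE; split => // j.
case: (unliftP ord0 j) => [j'|] ->; rewrite ?rV_cons0 ?rV_consS //.
by have := p2 j'; rewrite mxE.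
Qed.

Lemma measurable_rV_uncons : measurable_fun setT rV_uncons.
Proof.
apply: measurable_fun_pair.
  apply: (measurability _ (RGenOpens.measurableE R)) => _ [_ [a [b ->]] <-].
  rewrite setTI; apply: open_measurable_mx.
  by apply: open_comp => [v _|]; [exact: coord_continuous|exact: interval_open].
apply: (@measurability _ _ _ _ _ _ (@open 'rV[R]_n)) => // _ [U oU <-].
rewrite setTI; apply: open_measurable_mx; apply: open_comp => // v _.
move=> A /= /nbhs_ballP[e e0 eA]; apply/nbhs_ballP; exists e => // w.
move=> /rV_ballE[_ vw]; apply: eA; apply/rV_ballE; split => // j.
by rewrite !mxE; exact: vw.
Qed.

End rV_cons.

Section lebesgue_rV_step.
Local Open Scope ereal_scope.
Context {R : realType} (n : nat).
Variable mu : {sigma_finite_measure set 'rV[R]_n -> \bar R}.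

Definition rV_cons_measure : set 'rV[R]_n.+1 -> \bar R :=
  pushforward (@lebesgue_measure R \x mu) (@rV_cons R n).

Let m0 : rV_cons_measure set0 = 0.
Proof. by rewrite /rV_cons_measure /pushforward preimage_set0 measure0. Qed.

Let m_ge0 A : 0 <= rV_cons_measure A.
Proof. by rewrite /rV_cons_measure /pushforward; exact: measure_ge0. Qed.

Let m_sigma_additive : semi_sigma_additive rV_cons_measure.
Proof.
move=> F mF tF mUF; rewrite /rV_cons_measure /pushforward preimage_bigcup.
have mcons A : measurable A -> measurable (@rV_cons R n @^-1` A).
  by move=> mA; rewrite -[X in measurable X]setTI; exact: measurable_rV_cons.
apply: measure_semi_sigma_additive.
- by move=> k; exact: mcons.
- apply/trivIsetP => /= i j _ _ ij; rewrite -preimage_setI.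
  by move/trivIsetP : tF => /(_ _ _ _ _ ij) ->//; rewrite preimage_set0.
- by rewrite -preimage_bigcup; exact: mcons.
Qed.

HB.instance Definition _ := isMeasure.Build _ _ _ rV_cons_measure
  m0 m_ge0 m_sigma_additive.

Let m_sigma_finite : sigma_finite setT rV_cons_measure.
Proof.
have /sigma_finiteP[F [TF ndF Foo]] := sigma_finiteT (@lebesgue_measure R).
have /sigma_finiteP[G [TG ndG Goo]] := sigma_finiteT mu.
exists (fun k => @rV_uncons R n @^-1` (F k `*` G k)) => [|k].
  rewrite -preimage_bigcup (_ : \bigcup_i _ = setT) ?preimage_setT//.
  apply/seteqP; split => // -[x y] _.
  have [[k _ Fx] [l _ Gy]] : (\bigcup_i F i) x /\ (\bigcup_i G i) y.
    by rewrite -TF -TG.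
  exists (maxn k l) => //; split => /=.
    by move: Fx; exact/subsetPset/ndF/leq_maxl.
  by move: Gy; exact/subsetPset/ndG/leq_maxr.
have [mF Fk] := Foo k; have [mG Gk] := Goo k.
have mFG : measurable (F k `*` G k) by exact: measurableX.
split; first by rewrite -[X in measurable X]setTI; exact: measurable_rV_uncons.
rewrite /rV_cons_measure /pushforward -comp_preimage.
rewrite (_ : _ \o _ = id); last by apply/funext => p /=; rewrite rV_consK.
by rewrite preimage_id product_measure1E// lte_mul_pinfty// ge0_fin_numE.
Qed.

HB.instance Definition _ := Measure_isSigmaFinite.Build _ _ _ rV_cons_measure
  m_sigma_finite.

End lebesgue_rV_step.

(** Lebesgue measure on the Borel sets of R^n, as the image of the iterated
    product of the one-dimensional one under R x R^(n-1) ~ R^n. *)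
Fixpoint lebesgue_rV {R : realType} (n : nat) :
    {sigma_finite_measure set 'rV[R]_n -> \bar R} :=
  match n with
  | 0%N => \d_(0 : 'rV[R]_0)
  | k.+1 => rV_cons_measure (lebesgue_rV k)
  end.

Lemma lebesgue_rV_box {R : realType} (n : nat) (a b : 'I_n -> R) :
  (forall i, a i <= b i) ->
  lebesgue_rV n [set v : 'rV[R]_n | forall i, a i <= v ord0 i <= b i]
    = (\prod_(i < n) (b i - a i))%:E.
Proof.
elim: n => [|n IHn] in a b * => ab.
  by rewrite big_ord0 /= diracE mem_set// => -[].
have closed_box : closed [set v : 'rV[R]_n |
    forall i, a (lift ord0 i) <= v ord0 i <= b (lift ord0 i)].
  rewrite (_ : [set _ | _] = \bigcap_i
    (fun v : 'rV[R]_n => v ord0 i) @^-1` `[a (lift ord0 i), b (lift ord0 i)]).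
    apply: closed_bigI => i _; apply: preimage_closed => [v _|]; first exact: coord_continuous.
    exact: interval_closed.
  by apply/seteqP; split => v /= vab i; have := vab i; rewrite ?in_itv//=; exact.
have mbox := measurableC (open_measurable_mx (closed_openC closed_box)).
rewrite setCK in mbox.
rewrite [LHS]/= /rV_cons_measure /pushforward.
rewrite (_ : _ @^-1` _ = `[a ord0, b ord0] `*` [set v : 'rV[R]_n |
    forall i, a (lift ord0 i) <= v ord0 i <= b (lift ord0 i)]); last first.
  apply/seteqP; split => [p /= pab|p [/= p0 pS] i].
    split; first by have := pab ord0; rewrite rV_cons0 in_itv.
    by move=> i; have := pab (lift ord0 i); rewrite rV_consS.
  case: (unliftP ord0 i) => [j|] ->; first by rewrite rV_consS; exact: pS.
  by rewrite rV_cons0; move: p0; rewrite in_itv.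
rewrite product_measure1E; [|exact: measurable_itv|exact: mbox].
rewrite IHn; last by move=> i.
rewrite big_ord_recl EFinM; congr (_ * _)%E.
rewrite [LHS]lebesgue_measure_itv/= lte_fin.
have := ab ord0; rewrite le_eqVlt => /predU1P[->|->//].
by rewrite ltxx subrr.
Qed.

(** The library norm [`|x|] of ['rV[R]_d] is the sup norm, so that the
    Euclidean norm is introduced separately. *)

Definition dotv {R : realType} {d : nat} (u v : 'rV[R]_d) : R :=
  \sum_(i < d) u ord0 i * v ord0 i.

Definition enorm {R : realType} {d : nat} (u : 'rV[R]_d) : R :=
  Num.sqrt (dotv u u).

(** [hausdorff m] is the [m]-dimensional Hausdorff measure, normalized by the
    volume of the Euclidean unit ball of R^m, so that [hausdorff d.-1] is the
    surface measure [ds] on hypersurfaces of R^d. The test [C == set0] gives the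
    empty set gauge 0 also for [m = 0], where [0 ^+ 0 = 1]. *)

Section hausdorff.
Context {R : realType} {d : nat}.
Implicit Types A C : set 'rV[R]_d.

Definition unit_ball_volume (m : nat) : R :=
  fine (lebesgue_rV m [set x : 'rV[R]_m | enorm x <= 1]).

Definition diameter C : R := sup [set enorm (x - y) | x in C & y in C].

Definition hausdorff_gauge (m : nat) C : R :=
  if C == set0 then 0 else unit_ball_volume m * (diameter C / 2) ^+ m.

Definition hausdorff_delta (m : nat) (delta : R) A : \bar R :=
  ereal_inf [set (\sum_(0 <= k <oo) (hausdorff_gauge m (C k))%:E)%E
    | C in [set C : (set 'rV[R]_d)^nat | A `<=` \bigcup_k C k /\
        forall k x y, C k x -> C k y -> enorm (x - y) <= delta]].

Definition hausdorff (m : nat) A : \bar R :=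
  ereal_sup [set hausdorff_delta m delta A | delta in [set e : R | 0 < e]].

End hausdorff.

Section domains.
Context {R : realType} {d : nat}.
Implicit Types (Omega U : set 'rV[R]_d) (f g rho : 'rV[R]_d -> R^o).

Definition boundary Omega : set 'rV[R]_d := closure Omega `&` closure (~` Omega).

Definition surface_integral Omega g : R :=
  fine (\int[hausdorff d.-1]_(x in boundary Omega) (g x)%:E)%E.

Definition C1 U : set ('rV[R]_d -> R^o) :=
  [set f | forall x, U x ->
    differentiable f x /\ forall v, {for x, continuous ('D_v f)}].

(** Near [x], [Omega] is the sublevel set [rho < 0] of a C^1 function whose
    gradient at the boundary point [x] is a positive multiple of the unit
    vector [nu]. *)
Definition outward_unit_normal Omega (x nu : 'rV[R]_d) : Prop :=
  enorm nu = 1 /\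
  exists U rho (c : R), [/\ open U, U x & C1 U rho] /\
    [/\ forall y, U y -> (Omega y <-> rho y < 0), rho x = 0, 0 < c
      & forall v, 'D_v rho x = c * dotv nu v].

Definition regular_boundary Omega : set 'rV[R]_d :=
  [set x | boundary Omega x /\ exists nu, outward_unit_normal Omega x nu].

(** The boundary has finite surface measure and is a C^1 hypersurface with
    [Omega] on one side, except on a set of surface measure zero (edges,
    corners, ...). *)
Definition piecewise_smooth_boundary Omega : Prop :=
  (hausdorff d.-1 (boundary Omega) < +oo)%E /\
  hausdorff d.-1 (boundary Omega `\` regular_boundary Omega) = 0%E.

Definition outward_normal_field Omega (n : 'rV[R]_d -> 'rV[R]_d) : Prop :=
  forall x, regular_boundary Omega x -> outward_unit_normal Omega x (n x).

(** Functions on [Omega] are represented by total functions whose values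
    outside [Omega] are irrelevant; [cext Omega f] is the continuous extension
    of [f] from [Omega] to its closure. *)
Definition cext Omega f (x : 'rV[R]_d) : R := lim (f @ within Omega (nbhs x)).

Definition C1_closure Omega : set ('rV[R]_d -> R^o) :=
  [set f | C1 Omega f /\ forall x, closure Omega x ->
    cvg (f @ within Omega (nbhs x)) /\
    forall v, cvg ('D_v f @ within Omega (nbhs x))].

Definition is_basis Omega (F : set ('rV[R]_d -> R^o)) (K : nat)
    (f : 'I_K -> 'rV[R]_d -> R^o) : Prop :=
  F = [set g | exists c : 'I_K -> R,
        forall x, Omega x -> g x = \sum_(k < K) c k * f k x] /\
  forall c : 'I_K -> R,
    (forall x, Omega x -> \sum_(k < K) c k * f k x = 0) -> forall k, c k = 0.

Definition flux_integral Omega (n : 'rV[R]_d -> 'rV[R]_d) (xi : 'rV[R]_d) f g : R :=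
  surface_integral Omega
    (fun x => cext Omega f x * cext Omega g x * dotv xi (n x)).

Definition integration_by_parts_on Omega (n : 'rV[R]_d -> 'rV[R]_d)
    (xi : 'rV[R]_d) (F : set ('rV[R]_d -> R^o)) : Prop :=
  forall u v, F u -> F v ->
    \int[lebesgue_rV d]_(x in Omega) (u x * 'D_xi v x)
    + \int[lebesgue_rV d]_(x in Omega) ('D_xi u x * v x)
    = flux_integral Omega n xi u v.

End domains.

Section mfsbp.
Context {R : realType} {d N : nat}.
Variables (Omega : set 'rV[R]_d) (x : 'I_N -> 'rV[R]_d).
Implicit Types (F G : set ('rV[R]_d -> R^o)) (n : 'rV[R]_d -> 'rV[R]_d).

Definition nodal (f : 'rV[R]_d -> R^o) : 'cV[R]_N := \col_i cext Omega f (x i).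

Definition vandermonde (K : nat) (f : 'I_K -> 'rV[R]_d -> R^o) : 'M[R]_(N, K) :=
  \matrix_(i, k) cext Omega (f k) (x i).

Definition posdef (P : 'M[R]_N) : Prop :=
  P^T = P /\ forall v : 'cV[R]_N, v != 0 -> 0 < (v^T *m P *m v) ord0 ord0.

Definition boundary_matrix n (xi : 'rV[R]_d) F (B : 'M[R]_N) : Prop :=
  is_diag_mx B /\ forall f g, F f -> F g ->
    ((nodal f)^T *m B *m nodal g) ord0 ord0 = flux_integral Omega n xi f g.

Definition MFSBP n (xi : 'rV[R]_d) F (D P Q B : 'M[R]_N) : Prop :=
  [/\ D = invmx P *m Q,
      forall f, F f -> D *m nodal f = nodal ('D_xi f),
      posdef P,
      Q + Q^T = B
    & boundary_matrix n xi F B].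

Definition quadrature (w : 'I_N -> R) (f : 'rV[R]_d -> R^o) : R :=
  \sum_(i < N) w i * cext Omega f (x i).

Definition positive_quadrature (w : 'I_N -> R) : Prop := forall i, 0 < w i.

Definition exact_quadrature G (w : 'I_N -> R) : Prop :=
  forall g, G g -> quadrature w g = \int[lebesgue_rV d]_(y in Omega) g y.

Definition dsquare (xi : 'rV[R]_d) F : set ('rV[R]_d -> R^o) :=
  [set 'D_xi (fun y => f y * g y) | f in F & g in F].

End mfsbp.

(* Main.v *)
Require Import Defs.
From mathcomp Require Import all_boot all_order all_algebra.
From mathcomp Require Import all_classical all_reals all_analysis.

Set Implicit Arguments.
Unset Strict Implicit.
Unset Printing Implicit Defensive.

Import Order.TTheory GRing.Theory Num.Theory.
Import numFieldNormedType.Exports.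

Local Open Scope classical_set_scope.
Local Open Scope ring_scope.

(** Write V and W for the nodal values of the basis functions and of their
    derivatives along xi, and let P be the diagonal matrix of some weights w.
    The product rule at the nodes turns the quadrature of the derivatives of
    the products f_j f_k into the entries of V^T P W + W^T P V
    ([quadrature_derive_prod]), while the product rule in Omega and integration
    by parts turn their integrals into the entries of V^T B V
    ([Rintegral_derive_prod]). So exactness of the quadrature is the identity
      V^T (P W) + (P W)^T V = V^T B V,
    and, P being diagonal, positivity of w is positive definiteness of P.

    An operator with norm matrix P satisfies Q V = P W and Q + Q^T = B, which
    implies this identity at once. Conversely, the identity is the only
    obstruction to solving Q V = P W under Q + Q^T = B. Subtracting B / 2
    reduces this to finding an antisymmetric S with S V = C, where V^T C is
    antisymmetric. As V has a left inverse L, the matrix C L is a solution of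
    S V = C, and it can be corrected to an antisymmetric one
    ([antisymmetric_completion]).

    Splitting the integral of the product rule into two needs integrability:
    functions that extend continuously to the compact closure of Omega are
    bounded on Omega, and Omega has finite measure. *)

(** * Continuous extension to the closure *)

Section continuous_extension.
Context {R : realType} {d : nat} (Omega : set 'rV[R]_d).
Implicit Types f g : 'rV[R]_d -> R^o.

Lemma eq_cext f g x : (forall y, Omega y -> f y = g y) ->
  cext Omega f x = cext Omega g x.
Proof.
move=> fg; rewrite /cext; congr (lim _).
apply/seteqP; split; apply: near_eq_cvg; apply: (@nearW _ (nbhs x)) => y /= Oy;
  by rewrite fg.
Qed.

Lemma cext_Leibniz f f' g g' x : closure Omega x ->
  cvg (f @ within Omega (nbhs x)) -> cvg (f' @ within Omega (nbhs x)) ->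
  cvg (g @ within Omega (nbhs x)) -> cvg (g' @ within Omega (nbhs x)) ->
  cext Omega (fun y => f y * g' y + f' y * g y) x =
  cext Omega f x * cext Omega g' x + cext Omega f' x * cext Omega g x.
Proof.
move=> Ox cf cf' cg cg'; have FF := within_nbhs_proper Ox.
by apply: (@cvg_lim R^o) => //; apply: cvgD; apply: cvgM.
Qed.

Lemma cext_sum (K : nat) (c : 'I_K -> R) (h : 'I_K -> 'rV[R]_d -> R^o) x :
  closure Omega x -> (forall k, cvg (h k @ within Omega (nbhs x))) ->
  cext Omega (fun y => \sum_(k < K) c k * h k y) x =
  \sum_(k < K) c k * cext Omega (h k) x.
Proof.
move=> Ox ch; have FF := within_nbhs_proper Ox.
apply: (@cvg_lim R^o) => //.
apply: cvg_big => [|k _]; first exact: add_continuous.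
by apply: cvgM; [exact: cvg_cst|exact: ch].
Qed.

Lemma nodal_lincomb (N K : nat) (x : 'I_N -> 'rV[R]_d)
    (h : 'I_K -> 'rV[R]_d -> R^o) (c : 'cV[R]_K) g :
  (forall i, closure Omega (x i)) ->
  (forall k y, closure Omega y -> cvg (h k @ within Omega (nbhs y))) ->
  (forall y, Omega y -> g y = \sum_k c k ord0 * h k y) ->
  nodal Omega x g = vandermonde Omega x h *m c.
Proof.
move=> xO hcl gh; apply/colP => i; rewrite !mxE (eq_cext _ gh) cext_sum//.
  by apply: eq_bigr => k _; rewrite !mxE mulrC.
by move=> k; exact: hcl.
Qed.

End continuous_extension.

(** * Integrability on a bounded open set *)

Section integrability.
Context {R : realType} {d : nat} (Omega : set 'rV[R]_d).
Implicit Types h : 'rV[R]_d -> R^o.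

Lemma open_continuous_measurable_rV h : open Omega ->
  (forall y, Omega y -> {for y, continuous h}) ->
  measurable_fun Omega (h : _ -> measurableTypeR R).
Proof.
move=> oO ch.
apply: (measurability _ (measurable_realfun.RGenOpens.measurableE R)).
move=> _ [_ [a [b ->]] <-].
apply: open_measurable_mx; rewrite openE => y /= [Oy hy].
rewrite /interior; near=> z; split; first by near: z; exact: open_nbhs_nbhs.
near: z; apply: (ch y Oy); apply: open_nbhs_nbhs.
by split => //; exact: interval_open.
Unshelve. all: by end_near. Qed.

Lemma bounded_set_closure : bounded_set Omega -> bounded_set (closure Omega).
Proof.
move=> [M [Mr MO]]; exists M; split => // r Mr' y.
suff : closure Omega `<=` [set y | `|y| <= r] by move=> /[apply].
have cr : closed [set y : 'rV[R]_d | `|y| <= r].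
  apply: (@preimage_closed _ _ _ [set t : R^o | t <= r]) => [v _|].
    exact: norm_continuous.
  exact: closed_le.
rewrite [X in _ `<=` X](closure_id _).1//.
by apply: closureS => v /MO; exact.
Qed.

(** Near a point of the closure, [h] is within 1 of its limit there; by
    compactness of the closure these local bounds give a global one. *)
Lemma cvg_closure_bounded h : bounded_set Omega ->
  (forall y, closure Omega y -> cvg (h @ within Omega (nbhs y))) ->
  [bounded h y | y in Omega].
Proof.
move=> bO ch.
have cO : compact (closure Omega).
  apply: bounded_closed_compact; last exact: closed_closure.
  exact: bounded_set_closure.
have hK : \forall M \near +oo,
    closure Omega `<=` [set y | Omega y -> `|h y| <= M].
  apply: (compact_near_coveringP _).1 cO _ _ _ _ _ => y Oy.
  set l := lim (h @ within Omega (nbhs y)).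
  have /cvgrPdist_le /(_ _ ltr01) hl : h @ within Omega (nbhs y) --> l := ch y Oy.
  exists ([set z | Omega z -> `|l - h z| <= 1], [set M | `|l| + 1 <= M]).
    by split=> //=; exact: nbhs_pinfty_ge.
  move=> [z M] /= [hz lM] Oz; apply: le_trans lM.
  by rewrite -[h z](subKr l) (le_trans (ler_normB _ _))// lerD2l; exact: hz.
rewrite /bounded_near; apply: filterS hK => M hM y Oy.
by apply: hM => //; exact: subset_closure.
Qed.

Lemma lebesgue_rV_bounded : bounded_set Omega -> measurable Omega ->
  (lebesgue_rV d Omega < +oo)%E.
Proof.
move=> [M [_ MO]] mO.
have {}MO y : Omega y -> `|y| <= `|M| + 1.
  by apply: (MO (`|M| + 1)); rewrite (le_lt_trans (ler_norm _))// ltrDl.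
(* The norm of row vectors is the sup norm, so its balls are boxes. *)
pose box := [set v : 'rV[R]_d |
  forall i, - (`|M| + 1) <= v ord0 i <= `|M| + 1].
have mbox : measurable box.
  have cbox : closed box.
    rewrite (_ : box = \bigcap_i
      (fun v : 'rV[R]_d => v ord0 i) @^-1` `[- (`|M| + 1), `|M| + 1]).
      apply: closed_bigI => i _; apply: preimage_closed => [v _|].
        exact: coord_continuous.
      exact: interval_closed.
    apply/seteqP; split => v /= vab i; have := vab i; rewrite ?in_itv//=.
    exact.
  rewrite -[box]setCK; apply: measurableC; apply: open_measurable_mx.
  exact: closed_openC.
apply: (@le_lt_trans _ _ (lebesgue_rV d box)).
  apply: (le_measure (lebesgue_rV d)); [exact: mem_set|exact: mem_set|].
  move=> v /MO vM i; rewrite -ler_norml (le_trans _ vM)//.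
  rewrite [leRHS]mx_normrE.
  exact: (le_bigmax _ (fun i : 'I_1 * 'I_d => `|v i.1 i.2|) (ord0, i)).
rewrite lebesgue_rV_box ?ltry// => i.
by rewrite ge0_cp// addr_ge0.
Qed.

End integrability.

(** * The product rule in the domain, under the integral and at the nodes *)

Section product_rule.
Context {R : realType} {d : nat} (Omega : set 'rV[R]_d).
Implicit Types (f g : 'rV[R]_d -> R^o) (xi : 'rV[R]_d).

Lemma derive_lincomb (K : nat) (c : 'I_K -> R) (h : 'I_K -> 'rV[R]_d -> R^o)
    g xi y : open Omega -> (forall k, C1 Omega (h k)) ->
  (forall z, Omega z -> g z = \sum_(k < K) c k * h k z) -> Omega y ->
  'D_xi g y = \sum_(k < K) c k * 'D_xi (h k) y.
Proof.
move=> oO hC gh Oy.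
have dh k : derivable (h k) y xi.
  by apply: diff_derivable; exact: (hC k y Oy).1.
have e : \forall z \near y, g z = (\sum_(k < K) c k \*: h k) z.
  by apply: filterS (open_nbhs_nbhs (conj oO Oy)) => z /gh ->; rewrite fct_sumE.
rewrite (near_eq_derive _ e) derive_sum => [|k]; last exact: derivableZ.
by apply: eq_bigr => k _; rewrite deriveZ.
Qed.

Lemma derive_prod f g xi y : C1 Omega f -> C1 Omega g -> Omega y ->
  'D_xi (fun z => f z * g z : R^o) y = f y * 'D_xi g y + 'D_xi f y * g y.
Proof.
move=> fC gC Oy; have [[df _] [dg _]] := (fC y Oy, gC y Oy).
have dfg := @deriveM _ _ f g y xi (diff_derivable df) (diff_derivable dg).
by apply: (etrans dfg); congr (_ + _); exact: mulrC.
Qed.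

Lemma C1_closure_integrable_mul_derive f g xi :
  open Omega -> bounded_set Omega ->
  C1_closure Omega f -> C1_closure Omega g ->
  (lebesgue_rV d).-integrable Omega (EFin \o (fun y => f y * 'D_xi g y)).
Proof.
move=> oO bO [fC fcl] [gC gcl].
have mO : measurable Omega by exact: open_measurable_mx.
apply: measurable_bounded_integrable => //.
- exact: lebesgue_rV_bounded.
- apply: open_continuous_measurable_rV => // y Oy.
  apply: (@continuousM _ _ f ('D_xi g)).
    by apply: differentiable_continuous; exact: (fC y Oy).1.
  exact: (gC y Oy).2.
- apply: (@cvg_closure_bounded _ _ _ (fun y => f y * 'D_xi g y : R^o)) => // y Oy.
  have FF := within_nbhs_proper Oy.
  by apply: is_cvgM; [exact: (fcl y Oy).1|exact: (gcl y Oy).2].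
Qed.

Lemma Rintegral_derive_prod f g xi : open Omega -> bounded_set Omega ->
  C1_closure Omega f -> C1_closure Omega g ->
  \int[lebesgue_rV d]_(y in Omega) 'D_xi (fun z => f z * g z : R^o) y =
  \int[lebesgue_rV d]_(y in Omega) (f y * 'D_xi g y) +
  \int[lebesgue_rV d]_(y in Omega) ('D_xi f y * g y).
Proof.
move=> oO bO fC gC; rewrite -RintegralD; last 3 first.
- exact: open_measurable_mx.
- exact: C1_closure_integrable_mul_derive.
- under [X in _ \o X]eq_fun do rewrite mulrC.
  exact: C1_closure_integrable_mul_derive.
by apply: eq_Rintegral => y; rewrite inE => Oy; exact: derive_prod fC.1 gC.1 Oy.
Qed.

Lemma quadrature_derive_prod (N : nat) (x : 'I_N -> 'rV[R]_d) (w : 'I_N -> R)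
    f g xi :
  (forall i, closure Omega (x i)) ->
  C1_closure Omega f -> C1_closure Omega g ->
  quadrature Omega x w ('D_xi (fun z => f z * g z : R^o)) =
  ((nodal Omega x f)^T *m diag_mx (\row_i w i) *m nodal Omega x ('D_xi g) +
   (nodal Omega x ('D_xi f))^T *m diag_mx (\row_i w i) *m nodal Omega x g)
    ord0 ord0.
Proof.
move=> xO fC gC.
rewrite !mul_mx_diag 3!mxE -big_split /=; apply: eq_bigr => i _.
rewrite !mxE (eq_cext (g := fun y => f y * 'D_xi g y + 'D_xi f y * g y)).
  have [[cf cf'] [cg cg']] := (fC.2 _ (xO i), gC.2 _ (xO i)).
  by rewrite cext_Leibniz// mulrDr !mulrA ![w i * _]mulrC.
by move=> y Oy; exact: derive_prod fC.1 gC.1 Oy.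
Qed.

End product_rule.

(** * Matrices with prescribed symmetric part and prescribed action *)

(** [C *m L], with [L] a left inverse of [V], sends [V] to [C]; subtracting its
    transpose makes it antisymmetric but adds the error [- L^T *m C^T *m V].
    The last summand of the witness cancels this error, and is itself
    antisymmetric because [C^T *m V] is. *)
Lemma antisymmetric_completion {K : fieldType} {m p : nat} (V C : 'M[K]_(m, p)) :
  row_free V^T -> V^T *m C + C^T *m V = 0 ->
  exists S : 'M[K]_m, S + S^T = 0 /\ S *m V = C.
Proof.
move=> /row_freeP[M VM] VC.
have LV : M^T *m V = 1%:M by rewrite -[V]trmxK -trmx_mul VM trmx1.
move: M^T LV => {VM} L LV.
have X0 : L^T *m (C^T *m V) *m L + (L^T *m (C^T *m V) *m L)^T = 0.
  rewrite !trmx_mul !trmxK -!mulmxA -mulmxDr !mulmxA -mulmxDl addrC VC.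
  by rewrite mul0mx mulmx0.
exists (C *m L - L^T *m C^T + L^T *m (C^T *m V) *m L); split.
  rewrite [X in _ + X]linearD /= addrACA X0 addr0.
  by rewrite linearB /= !trmx_mul !trmxK addrA subrK subrr.
rewrite mulmxDl mulmxBl -!mulmxA LV !mulmx1.
by rewrite -addrA addNr addr0.
Qed.

Lemma symmetric_part_completion {K : numFieldType} {m p : nat}
    (B : 'M[K]_m) (V C : 'M[K]_(m, p)) :
  B^T = B -> row_free V^T -> V^T *m C + C^T *m V = V^T *m B *m V ->
  exists Q : 'M[K]_m, Q + Q^T = B /\ Q *m V = C.
Proof.
move=> BT Vfree VC; pose H := (2^-1 : K) *: B.
have HB : H + H = B by rewrite -scalerDl -[2^-1]mul1r -splitr scale1r.
have HT : H^T = H by rewrite linearZ /= BT.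
have [|S [SS SV]] := antisymmetric_completion (C := C - H *m V) Vfree.
  rewrite [(_ - _)^T]linearB /= trmx_mul HT mulmxBr mulmxBl addrACA VC -HB.
  by rewrite mulmxDr mulmxDl !mulmxA -opprD subrr.
exists (H + S); split; last by rewrite mulmxDl SV addrC subrK.
by rewrite linearD /= HT addrACA SS HB addr0.
Qed.

Lemma mul_tr_mx_entry {K : comNzRingType} {m p q : nat} (A : 'M[K]_(m, p))
    (M : 'M[K]_m) (C : 'M[K]_(m, q)) j k :
  (A^T *m M *m C) j k = ((col j A)^T *m M *m col k C) ord0 ord0.
Proof. by rewrite tr_col -row_mul !mxE; apply: eq_bigr => i _; rewrite !mxE. Qed.

Lemma posdef_diag_mx {K : realType} {m : nat} (r : 'rV[K]_m) :
  posdef (diag_mx r) <-> forall i, 0 < r ord0 i.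
Proof.
have quad (v : 'cV[K]_m) : (v^T *m diag_mx r *m v) ord0 ord0 =
    \sum_i r ord0 i * v i ord0 ^+ 2.
  rewrite mul_mx_diag mxE; apply: eq_bigr => i _.
  by rewrite !mxE mulrAC mulrC expr2.
split=> [[_ rP] i|r0].
  have /rP : delta_mx i ord0 != 0 :> 'cV[K]_m.
    apply/eqP => /matrixP /(_ i ord0); rewrite !mxE !eqxx => /eqP.
    by rewrite oner_eq0.
  rewrite quad (bigD1 i)//= big1 => [|j ji]; last first.
    by rewrite mxE (negbTE ji) expr0n mulr0.
  by rewrite mxE !eqxx expr1n mulr1 addr0.
split=> [|v v0]; first by rewrite tr_diag_mx.
have /cV0Pn[i vi] := v0.
rewrite quad (bigD1 i)//=; apply: ltr_wpDr; last first.
  by rewrite mulr_gt0// exprn_even_gt0.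
by apply: sumr_ge0 => j _; rewrite mulr_ge0 ?sqr_ge0// ltW.
Qed.

Lemma unitmx_diag_gt0 {K : numFieldType} {m : nat} (r : 'rV[K]_m) :
  (forall i, 0 < r ord0 i) -> diag_mx r \in unitmx.
Proof.
move=> r0; rewrite unitmxE det_diag unitfE.
by apply/prodf_neq0 => i _; rewrite gt_eqF.
Qed.

(** * Diagonal-norm operators and positive exact quadratures *)

Theorem theorem4p1 (R : realType) (d N K : nat)
    (Omega : set 'rV[R]_d) (n : 'rV[R]_d -> 'rV[R]_d) (xi : 'rV[R]_d)
    (x : 'I_N -> 'rV[R]_d)
    (F : set ('rV[R]_d -> R^o)) (f : 'I_K -> 'rV[R]_d -> R^o)
    (B : 'M[R]_N)
    (Omega_open : open Omega) (Omega_bounded : bounded_set Omega)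
    (Omega_boundary : piecewise_smooth_boundary Omega)
    (n_normal : outward_normal_field Omega n)
    (xi_unit : enorm xi = 1)
    (x_inj : injective x) (x_closure : forall i, closure Omega (x i))
    (F_C1 : F `<=` C1_closure Omega) (F_basis : is_basis Omega F f)
    (F_ibp : integration_by_parts_on Omega n xi F)
    (V_free : row_free (vandermonde Omega x f)^T)
    (B_boundary : boundary_matrix Omega x n xi F B) :
  (exists D P Q : 'M[R]_N, MFSBP Omega x n xi F D P Q B /\ is_diag_mx P) <->
  (exists w : 'I_N -> R, positive_quadrature w /\
     exact_quadrature Omega x (dsquare xi F) w).
Proof.
have flux g h : F g -> F h ->
    \int[lebesgue_rV d]_(y in Omega) 'D_xi (fun z => g z * h z : R^o) y =
    ((nodal Omega x g)^T *m B *m nodal Omega x h) ord0 ord0.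
  move=> Fg Fh; rewrite B_boundary.2// -F_ibp//.
  by rewrite Rintegral_derive_prod//; exact: F_C1.
split.
  move=> [D [P [Q [[DE DF Ppos QB _] /diag_mxP[r PE]]]]].
  rewrite {}PE in DE Ppos.
  have r0 := (posdef_diag_mx r).1 Ppos.
  have PD : diag_mx r *m D = Q by rewrite DE mulKVmx// unitmx_diag_gt0.
  exists (fun i => r ord0 i); split; first exact: r0.
  move=> _ [g Fg [h Fh <-]].
  rewrite quadrature_derive_prod//; [|exact: F_C1..].
  rewrite flux// (_ : \row_i _ = r); last by apply/rowP => i; rewrite mxE.
  (* As P D = Q, both sides are (nodal g)^T (Q + Q^T) (nodal h). *)
  rewrite -!DF// -QB -PD !trmx_mul tr_diag_mx.
  by rewrite mulmxDr mulmxDl !mulmxA.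
move=> [w [w0 wE]].
have Ff k : F (f k).
  rewrite F_basis.1; exists (fun j => (j == k)%:R) => y _.
  by rewrite (bigD1 k)//= eqxx mul1r big1 ?addr0// => j /negbTE ->; rewrite mul0r.
pose P := diag_mx (\row_i w i).
pose V := vandermonde Omega x f.
pose W := vandermonde Omega x (fun k => 'D_xi (f k)).
have Vk k : col k V = nodal Omega x (f k) by apply/colP => i; rewrite !mxE.
have Wk k : col k W = nodal Omega x ('D_xi (f k)).
  by apply/colP => i; rewrite !mxE.
have P0 i : 0 < (\row_i w i) ord0 i by rewrite mxE.
have PT : P^T = P by exact: tr_diag_mx.
have [|||Q [QB QV]] := @symmetric_part_completion _ _ _ B V (P *m W).
- by have /diag_mxP[b ->] := B_boundary.1; exact: tr_diag_mx.
- exact: V_free.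
- (* Entry (j, k) is exactness of w for the derivative of f_j f_k. *)
  rewrite [(P *m W)^T]trmx_mul PT mulmxA; apply/matrixP => j k.
  rewrite [LHS]mxE.
  rewrite (mul_tr_mx_entry V P W) (mul_tr_mx_entry W P V) (mul_tr_mx_entry V B V).
  rewrite !Vk !Wk -flux// -wE; last by exists (f j) => //; exists (f k).
  rewrite quadrature_derive_prod//; [|exact: F_C1..].
  by rewrite [RHS]mxE.
exists (invmx P *m Q), P, Q; split; last exact: diag_mx_is_diag.
split => // [g Fg|]; last exact/posdef_diag_mx.
have [c gc] : exists c : 'I_K -> R,
    forall y, Omega y -> g y = \sum_(k < K) c k * f k y.
  by move: Fg; rewrite F_basis.1.
rewrite (@nodal_lincomb _ _ _ _ _ _ f (\col_k c k))//; last 2 first.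
- by move=> k y Oy; exact: ((F_C1 _ (Ff k)).2 y Oy).1.
- by move=> y Oy; rewrite gc//; apply: eq_bigr => k _; rewrite mxE.
rewrite (@nodal_lincomb _ _ _ _ _ _ (fun k => 'D_xi (f k)) (\col_k c k))//;
  last 2 first.
- by move=> k y Oy; exact: ((F_C1 _ (Ff k)).2 y Oy).2.
- move=> y Oy; rewrite (@derive_lincomb _ _ Omega _ c f)//.
    by apply: eq_bigr => k _; rewrite mxE.
  by move=> k; exact: (F_C1 _ (Ff k)).1.
rewrite mulmxA -[invmx P *m Q *m _]mulmxA QV mulKmx//.
exact: unitmx_diag_gt0.
Qed.
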